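(* Consider a nontrivial $m$-cycle of $C$ with local minima $n_1,\dots,n_m$ (indices extended periodically). For every integer $m_1\geq 0$, $\sum_{i=1}^{m_1}T(n_i)<\frac{97m_1+73}{54}\cdot\frac{1}{X_0}.$
   Context: $C(n)=n/2$ for even $n$, $C(n)=(3n+1)/2$ for odd $n$ (on positive integers); $C^t$ is the $t$-fold iterate. A nontrivial cycle is a set $\{n,C(n),\dots,C^{p-1}(n)\}$ with $C^p(n)=n$, different from $\{1,2\}$. A local minimum of the cycle is an element smaller than its predecessor and successor along the cycle (equivalently, an odd element whose predecessor is even). An $m$-cycle is a nontrivial cycle with exactly $m$ local minima; list them as $n_1,\dots,n_m$ in order of appearance along the cycle (starting at any of them) and set $n_{i+m}:=n_i$. For each $i$, $k_i\geq1$ is such that $n_i,C(n_i),\dots,C^{k_i-1}(n_i)$ are odd and $C^{k_i}(n_i)$ is even. Define $T(n_i):=\sum_{t=0}^{k_i-1}\frac{1}{C^t(n_i)}$. $X_0$ is a positive integer with $X_0>765$ such that for every positive integer $n\leq X_0$ the sequence $n,C(n),C^2(n),\dots$ eventually reaches $1$. *)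

(* Defs.v *)
From mathcomp Require Import all_boot all_order all_algebra.

Set Implicit Arguments.
Unset Strict Implicit.
Unset Printing Implicit Defensive.

Import Order.TTheory GRing.Theory Num.Theory.

Definition collatz (n : nat) : nat :=
  if odd n then (3 * n + 1)./2 else n./2.

(* A cycle is represented by the sequence of its elements in order of
   appearance.  The starting element n is arbitrary, so a given cycle is
   represented by all the rotations of such a sequence.  The condition [uniq c]
   makes p the least period, i.e., c goes around the cycle exactly once. *)
Definition nontrivial_cycle (c : seq nat) : Prop :=
  (exists n p : nat,
     [/\ 0 < n, 0 < p, iter p collatz n = n & c = traject collatz n p])
  /\ uniq c /\ ~ (c =i [:: 1; 2]).

Definition local_min (c : seq nat) (x : nat) : bool :=
  (x < prev c x) && (x < next c x).

Definition m_cycle (m : nat) (c : seq nat) : Prop :=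
  nontrivial_cycle c /\ count (local_min c) c = m.

(* The family n_1, ..., n_m lists the local minima in order of appearance, from
   the first one met along c, and is extended periodically. Every choice of n_1
   is obtained by rotating c. *)
Definition lists_local_minima (m : nat) (c : seq nat) (n_ : nat -> nat) : Prop :=
  [seq n_ i | i <- iota 1 m] = [seq x <- c | local_min c x]
  /\ forall i, n_ (i + m) = n_ i.

Definition odd_run (n k : nat) : Prop :=
  [/\ 1 <= k, forall t, t < k -> odd (iter t collatz n)
    & ~~ odd (iter k collatz n)].

Definition T (n k : nat) : rat :=
  (\sum_(0 <= t < k) 1 / (iter t collatz n)%:R)%R.

(* Main.v *)
Require Import Defs.
From mathcomp Require Import all_boot all_order all_algebra.
From mathcomp Require Import zify lra.
Import Order.TTheory GRing.Theory Num.Theory.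

(* Every positive integer whose trajectory meets the cycle exceeds X0.  Write a
   local minimum as n = 2^k q - 1 with q odd.  If C^(k+1)(n) is even, then
   (n-1)/2 merges with the trajectory of n, so n > 2 X0 and T(n) < 3/(2 X0).
   Otherwise C^(k+1)(n) >= (3/2)^k n / 2 is the next local minimum, so a long
   odd run makes the next term small.  Since T(n) <= 3 (1 - (2/3)^k) / n, the
   sum splits into blocks of one, two or three consecutive terms of average at
   most 97/54 / X0, up to one incomplete final block absorbed by 73/54. *)

(** * Arithmetic of [collatz] along odd runs *)

Lemma collatz_odd n : odd n -> (collatz n).*2 = 3 * n + 1.
Proof. by rewrite /collatz => /[dup] on ->; lia. Qed.

Lemma collatz_even n : ~~ odd n -> (collatz n).*2 = n.
Proof. by rewrite /collatz => /[dup] en /negPf ->; lia. Qed.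

Lemma collatz_gt0 n : 0 < n -> 0 < collatz n.
Proof. by have [/collatz_odd|/collatz_even] := boolP (odd n); lia. Qed.

Lemma iter_collatz_gt0 t n : 0 < n -> 0 < iter t collatz n.
Proof. by move=> n0; elim: t => //= t /collatz_gt0. Qed.

Lemma collatz_neq n : 0 < n -> collatz n != n.
Proof. by have [/collatz_odd|/collatz_even] := boolP (odd n); lia. Qed.

Lemma iter_collatz1 t : iter t collatz 1 \in [:: 1; 2].
Proof. by elim: t => //= t; rewrite !inE => /orP[] /eqP ->. Qed.

Lemma collatz_double_pred a : 0 < a -> collatz (2 * a).-1 = (3 * a).-1.
Proof.
by move=> a0; have /collatz_odd : odd (2 * a).-1; lia.
Qed.

Lemma iter_collatz_pow2 t a :
  0 < a -> iter t collatz (2 ^ t * a).-1 = (3 ^ t * a).-1.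
Proof.
elim: t a => [|t IH] a a0; first by rewrite !mul1n.
rewrite iterSr expnS -mulnA collatz_double_pred ?muln_gt0 ?expn_gt0 //.
by rewrite mulnCA IH ?muln_gt0 // expnSr mulnA.
Qed.

(** By induction from C(n) = 2^k q - 1: since 2 C(n) = 3n + 1, this gives 3(n+1) = 2^(k+1) q, so 3
    divides q, and q/3 is the odd cofactor for n. *)
Lemma odd_runE n k : odd_run n k -> exists2 q, odd q & n = (2 ^ k * q).-1.
Proof.
case=> _; elim: k n => [|k IH] n ho he.
  by exists n.+1; rewrite ?mul1n //= in he *.
have on : odd n := ho 0 isT.
have [||q oq Cn] := IH (collatz n).
- by move=> t tk; rewrite -iterSr; exact: ho.
- by rewrite -iterSr.
have q0 : 0 < 2 ^ k * q by rewrite muln_gt0 expn_gt0; lia.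
have E : 3 * n.+1 = 2 ^ k.+1 * q.
  by move: (collatz_odd n on); rewrite Cn expnS -mulnA; lia.
have /dvdnP[r rq] : 3 %| q.
  by rewrite -(@Gauss_dvdr 3 (2 ^ k.+1)) ?coprimeXr // -E dvdn_mulr.
exists r; first by move: oq; rewrite rq oddM andbT.
by rewrite rq mulnCA mulnA in E; lia.
Qed.

Lemma odd_run_pow n k t :
  odd_run n k -> t <= k -> 3 ^ t * n <= 2 ^ t * iter t collatz n.
Proof.
move=> [_ ho _]; elim: t => [|t IH] tk; first by rewrite !mul1n.
have := collatz_odd _ (ho t tk); have := IH (ltnW tk).
rewrite !expnS /=; nia.
Qed.

Lemma odd_run_lt n k t :
  odd_run n k -> 0 < t <= k -> n < iter t collatz n.
Proof.
move=> [_ ho _]; elim: t => // -[_ tk|t IH /andP[_ tk]].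
  by have /= := collatz_odd _ (ho 0 tk); lia.
have /= := collatz_odd _ (ho t.+1 tk); have /= := IH (ltnW tk); lia.
Qed.

(* With n = 2^k q - 1, both trajectories pass through (3^k q - 1) / 4. *)
Lemma odd_run_merge n k :
  odd_run n k -> ~~ odd (iter k.+1 collatz n) ->
  iter k.+1 collatz n./2 = iter k.+2 collatz n.
Proof.
move=> nk; have [q oq nE] := odd_runE _ _ nk; case: nk => k0 _ ek ek1.
case: k k0 nE ek ek1 => // k _ nE.
have q0 : 0 < q by lia.
have a0 : 0 < 2 ^ k * q by rewrite muln_gt0 expn_gt0.
have b0 : 0 < 3 ^ k * q by rewrite muln_gt0 expn_gt0.
have -> : n./2 = (2 ^ k * q).-1 by rewrite nE expnS -mulnA; lia.
rewrite !iterS iter_collatz_pow2 // nE -iterS iter_collatz_pow2 //.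
(* The paths of n/2 and n are now at b - 1 and 3b - 1. The parity hypotheses say that 4 divides 3b -
   1, so b = 3 mod 4 and (b-1)/2 is odd. *)
rewrite (expnS 3) -mulnA; move: (3 ^ k * q) b0 => b b0 e1 e2.
have h1 := collatz_even _ e1; have h2 := collatz_even _ e2.
have h3 : ~~ odd b.-1 by lia.
have h4 := collatz_even _ h3.
have h5 : odd (collatz b.-1) by lia.
by have := collatz_odd _ h5; lia.
Qed.

(** * Cycles, their local minima and the order of these *)

Lemma nontrivial_cycle_rot c x : nontrivial_cycle c -> x \in c ->
  iter (size c) collatz x = x /\
  exists j, rot j c = traject collatz x (size c).
Proof.
move=> [[n [p [n0 p0 np ->]]] _] /trajectP[i ip ->].
rewrite size_traject; split; first by rewrite -iterD addnC iterD np.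
exists i; have {1}-> : p = i + (p - i) by lia.
rewrite trajectD -[X in rot X](size_traject collatz n i) rot_size_cat.
have -> : traject collatz n i
    = traject collatz (iter (p - i) collatz (iter i collatz n)) i.
  by rewrite -iterD subnK ?np // ltnW.
by rewrite -trajectD subnK // ltnW.
Qed.

Lemma nontrivial_cycle_gt0 c x : nontrivial_cycle c -> x \in c -> 0 < x.
Proof.
move=> [[n [p [n0 p0 np ->]]] _] /trajectP[i ip ->]; exact: iter_collatz_gt0.
Qed.

Lemma next_head (T : eqType) (x : T) s : next (x :: s) x = head x s.
Proof. by rewrite next_nth mem_head /= eqxx nth0. Qed.

Lemma filter_rot (T : Type) (P : pred T) j s :
  filter P (rot j s) = rot (count P (take j s)) (filter P s).
Proof.
rewrite -{3}(cat_take_drop j s) filter_cat -size_filter rot_size_cat.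
by rewrite -filter_cat.
Qed.

(** Rotate c to start at x. The trajectory on the right ends with x itself, so its filter is
    nonempty and the case where x alone satisfies P is covered. *)
Lemma next_filter_cycle (P : pred nat) c x :
  nontrivial_cycle c -> x \in c -> P x ->
  next (filter P c) x
    = head x (filter P (traject collatz (collatz x) (size c))).
Proof.
move=> hc xc Px; have [px [j rj]] := nontrivial_cycle_rot _ _ hc xc.
have uc : uniq c by case: hc => _ [].
rewrite -(next_rot (count P (take j c))) ?filter_uniq // -filter_rot rj.
have : 0 < size c by case: (c) xc.
case: (size c) px => // p px _.
rewrite [in RHS]trajectSr -iterSr px /= Px next_head.
by rewrite filter_rcons Px; case: filter.
Qed.

Lemma next_cycleE c x :
  nontrivial_cycle c -> x \in c -> next c x = collatz x.
Proof.
move=> hc xc; rewrite -[in LHS](filter_predT c) next_filter_cycle //.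
by rewrite filter_predT; case: (c) xc.
Qed.

Lemma collatz_cycle c x : nontrivial_cycle c -> x \in c -> collatz x \in c.
Proof. by move=> hc xc; rewrite -(next_cycleE c) // mem_next. Qed.

Lemma iter_collatz_cycle c x t :
  nontrivial_cycle c -> x \in c -> iter t collatz x \in c.
Proof. by move=> hc xc; elim: t => //= t; exact: collatz_cycle. Qed.

Lemma prev_collatz c x :
  nontrivial_cycle c -> x \in c -> prev c (collatz x) = x.
Proof.
by move=> hc xc; rewrite -(next_cycleE c) // prev_next //; case: hc => _ [].
Qed.

Lemma nontrivial_cycle1 c : nontrivial_cycle c -> 1 \notin c.
Proof.
move=> hc; apply/negP => c1; have [_ [_]] := hc; apply => x.
have [_ [j rj]] := nontrivial_cycle_rot _ _ hc c1.
apply/idP/idP => [|].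
  by rewrite -(mem_rot j) rj => /trajectP[i _ ->]; exact: iter_collatz1.
by rewrite !inE => /orP[]/eqP -> //; exact: (collatz_cycle c 1).
Qed.

(** If y <= X0, then y reaches 1, so the iterates of C^s(y) enter {1, 2}. They also stay in c, which
    would then contain 1. *)
Lemma merge_cycle_gt (X0 : nat) c y s :
  (forall n, 0 < n -> n <= X0 -> exists t, iter t collatz n = 1) ->
  nontrivial_cycle c -> iter s collatz y \in c -> X0 < y.
Proof.
move=> hreach hc ysc; rewrite ltnNge; apply/negP => yX.
have y0 : 0 < y.
  (* 0 is a fixed point of [collatz], so it never leads into a cycle of positive integers. *)
  have := nontrivial_cycle_gt0 _ _ hc ysc; case: (y) => //.
  by rewrite iter_fix.
have [t yt] := hreach y y0 yX.
have := iter_collatz_cycle c _ t hc ysc; rewrite -iterD addnC iterD yt.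
have := iter_collatz1 s; rewrite !inE => /orP[]/eqP ->.
  exact/negP/nontrivial_cycle1.
by move/(collatz_cycle _ _ hc); exact/negP/nontrivial_cycle1.
Qed.

(** On positive integers C increases exactly at odd arguments. Writing the element as C(x) makes its
    predecessor explicit. *)
Lemma local_min_collatz c x : nontrivial_cycle c -> x \in c ->
  local_min c (collatz x) = ~~ odd x && odd (collatz x).
Proof.
move=> hc xc; have c2 := collatz_cycle _ _ hc xc.
rewrite /local_min prev_collatz // next_cycleE //.
have x0 := nontrivial_cycle_gt0 _ _ hc xc.
have y0 := nontrivial_cycle_gt0 _ _ hc c2.
have [/collatz_odd|/collatz_even] := boolP (odd x);
have [/collatz_odd|/collatz_even] := boolP (odd (collatz x)); lia.
Qed.

(** The least element works: C has no positive fixed point, so both of its neighbours are strictly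
    larger. This gives m > 0, needed for indices modulo m. *)
Lemma has_local_min c : nontrivial_cycle c -> has (local_min c) c.
Proof.
move=> hc; have [[n [p [n0 p0 np cE]]] _] := hc.
have ex : exists x, x \in c.
  by exists n; rewrite cE; case: (p) p0 => // ? _; rewrite mem_head.
case: (ex_minnP ex) => x xc xmin; apply/hasP; exists x => //.
have pc : prev c x \in c by rewrite mem_prev.
have cp : collatz (prev c x) = x.
  by rewrite -(next_cycleE c) // next_prev //; case: hc => _ [].
rewrite /local_min next_cycleE // !ltn_neqAle !xmin ?collatz_cycle // !andbT.
rewrite -{1}cp collatz_neq ?(nontrivial_cycle_gt0 c) // eq_sym.
by rewrite collatz_neq ?(nontrivial_cycle_gt0 c).
Qed.

(** C(x), ..., C^k(x) all have odd predecessors, so none is a local minimum, whereas C^(k+1)(x) is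
    odd after an even element. *)
Lemma next_local_min c x k :
  nontrivial_cycle c -> x \in c -> local_min c x -> odd_run x k ->
  odd (iter k.+1 collatz x) ->
  next (filter (local_min c) c) x = iter k.+1 collatz x.
Proof.
move=> hc xc mx xk ok; have [k0 ho he] := xk.
have [px _] := nontrivial_cycle_rot _ _ hc xc.
(* Otherwise x would recur inside its own odd run, whose later iterates all exceed x. *)
have kp : k < size c.
  rewrite ltnNge; apply/negP => pk; have := odd_run_lt x k (size c) xk.
  by rewrite px ltnn pk andbT; case: (c) xc => // a s _ /(_ isT).
rewrite next_filter_cycle //; have -> : size c = k + (size c - k).-1.+1 by lia.
rewrite trajectD filter_cat -iterSr.
have -> : [seq y <- traject collatz (collatz x) k | local_min c y] = [::].
  rewrite -(eq_in_filter (a1 := pred0)) ?filter_pred0 // => y /trajectP[i ik ->].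
  by rewrite -iterSr iterS local_min_collatz ?iter_collatz_cycle // ho.
by rewrite trajectS /= local_min_collatz ?iter_collatz_cycle // he ok.
Qed.

Lemma lists_local_minima_nth m c n_ :
  m_cycle m c -> lists_local_minima m c n_ ->
  forall i, n_ i.+1 = nth 0 [seq x <- c | local_min c x] (i %% m).
Proof.
move=> [hc cm] [nE nper] i.
have m0 : 0 < m by rewrite -cm -has_count; exact: has_local_min.
have per j t : n_ (t + j * m) = n_ t.
  by elim: j => [|j IH]; rewrite ?addn0 // mulSn addnCA addnC nper.
rewrite {1}(divn_eq i m) addnC -addSn per -nE.
by rewrite (nth_map 0) ?size_iota ?nth_iota ?ltn_pmod.
Qed.

Lemma lists_local_minima_mem m c n_ i :
  m_cycle m c -> lists_local_minima m c n_ ->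
  n_ i.+1 \in [seq x <- c | local_min c x].
Proof.
move=> mc hn; rewrite (lists_local_minima_nth m c) // mem_nth //.
case: (mc) => hc cm; rewrite size_filter cm ltn_pmod // -cm -has_count.
exact: has_local_min.
Qed.

Lemma lists_local_minima_next m c n_ i :
  m_cycle m c -> lists_local_minima m c n_ ->
  n_ i.+2 = next [seq x <- c | local_min c x] (n_ i.+1).
Proof.
move=> mc hn; have M := lists_local_minima_mem _ _ _ i mc hn.
rewrite next_nth M !(lists_local_minima_nth m c) //.
case: (mc) => hc cm; have sz := size_filter (local_min c) c; rewrite cm in sz.
have um : uniq [seq x <- c | local_min c x].
  by apply: filter_uniq; case: hc => _ [].
have m0 : 0 < m by rewrite -cm -has_count; exact: has_local_min.
rewrite index_uniq ?sz ?ltn_pmod // -addn1 -modnDml addn1.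
have : i %% m < m by rewrite ltn_pmod.
move: (i %% m) => j; case: filter sz => [|a s] /=; first by lia.
(* At the last index the successor wraps around to 0, and [next] returns the head as the default
   value of [nth]. *)
move=> <- js; have [->|jn] := eqVneq j (size s).
  by rewrite modnn [RHS]nth_default.
by rewrite modn_small /=; [apply: set_nth_default|]; lia.
Qed.

(** * Bounds for [T] and for the reciprocal of the next local minimum *)

Local Open Scope ring_scope.

Lemma exp23_ge0 k : 0 <= (2 / 3) ^+ k :> rat.
Proof. by rewrite exprn_ge0 ?divr_ge0 ?ler0n. Qed.

Lemma exp23_le j k : (j <= k)%N -> (2 / 3) ^+ k <= (2 / 3) ^+ j :> rat.
Proof.
apply: ler_wiXn2l; first by rewrite divr_ge0 ?ler0n.
by rewrite ler_pdivrMr ?ltr0n // mul1r ler_nat.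
Qed.

(** Each odd step multiplies by at least 3/2, so the sum is dominated by a geometric series of ratio
    2/3. *)
Lemma T_le n k : (0 < n)%N -> odd_run n k ->
  T n k <= 3 * (1 - (2 / 3) ^+ k) * n%:R^-1.
Proof.
move=> n0 nk; rewrite /T.
suff H t : (t <= k)%N -> \sum_(0 <= s < t) 1 / (iter s collatz n)%:R
    <= 3 * (1 - (2 / 3) ^+ t) * n%:R^-1 :> rat by exact: H.
elim: t => [|t IH] tk; first by rewrite big_geq // expr0 subrr mulr0 mul0r.
rewrite big_nat_recr //= exprSr; have := IH (ltnW tk).
have nR : 0 < n%:R :> rat by rewrite ltr0n.
have : 1 / (iter t collatz n)%:R <= (2 / 3) ^+ t * n%:R^-1 :> rat.
  rewrite ler_pdivrMr ?ltr0n ?iter_collatz_gt0 // mulrAC ler_pdivlMr // mul1r.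
  rewrite expr_div_n mulrAC ler_pdivlMr ?exprn_gt0 // mulrC -!natrX -!natrM.
  by rewrite ler_nat; exact: odd_run_pow (ltnW tk).
lra.
Qed.

Lemma T_le_small j n k : (0 < n)%N -> odd_run n k -> (k <= j)%N ->
  T n k <= 3 * (1 - (2 / 3) ^+ j) * n%:R^-1.
Proof.
move=> n0 nk kj; apply: le_trans (T_le _ _ n0 nk) _.
rewrite ler_wpM2r ?invr_ge0 ?ler0n // ler_wpM2l // lerD2l lerN2.
exact: exp23_le.
Qed.

Lemma T_le3 n k : (0 < n)%N -> odd_run n k -> T n k <= 3 * n%:R^-1.
Proof.
move=> n0 nk; apply: le_trans (T_le _ _ n0 nk) _.
rewrite ler_wpM2r ?invr_ge0 ?ler0n //.
by have := exp23_ge0 k; lra.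
Qed.

(** The factor 2 comes from the single halving that follows the k odd steps. *)
Lemma inv_collatz_odd_run n k : (0 < n)%N -> odd_run n k ->
  (iter k.+1 collatz n)%:R^-1 <= 2 * (2 / 3) ^+ k * n%:R^-1 :> rat.
Proof.
move=> n0 nk; have nR : 0 < n%:R :> rat by rewrite ltr0n.
have xn := odd_run_pow _ _ _ nk (leqnn k).
case: nk => _ _ /collatz_even E; rewrite -{}E in xn; rewrite iterS.
set x := collatz _ in xn *.
have x0 : 0 < x%:R :> rat by rewrite ltr0n; exact: (iter_collatz_gt0 k.+1).
rewrite -[leLHS]mul1r ler_pdivrMr // mulrAC ler_pdivlMr // mul1r.
rewrite expr_div_n mulrA mulrAC ler_pdivlMr ?exprn_gt0 // mulrC.
by rewrite -!natrX -!natrM ler_nat; move: xn; rewrite -mul2n; nia.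
Qed.

Lemma inv_collatz_odd_run_ge j n k : (0 < n)%N -> odd_run n k -> (j <= k)%N ->
  (iter k.+1 collatz n)%:R^-1 <= 2 * (2 / 3) ^+ j * n%:R^-1 :> rat.
Proof.
move=> n0 nk jk; apply: le_trans (inv_collatz_odd_run _ _ n0 nk) _.
rewrite ler_wpM2r ?invr_ge0 ?ler0n // ler_wpM2l //.
exact: exp23_le.
Qed.

(** With r = (2/3)^k the two terms contribute 3(1 - r) and 3 * 2r. The total 3(1 + r) decreases in
    k, so only a lower bound j on k matters. *)
Lemma T_pair_le j n k k' : (0 < n)%N -> odd_run n k ->
  odd_run (iter k.+1 collatz n) k' -> (j <= k)%N ->
  T n k + T (iter k.+1 collatz n) k' <= 3 * (1 + (2 / 3) ^+ j) * n%:R^-1.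
Proof.
move=> n0 nk nk' jk; have := T_le3 _ _ (iter_collatz_gt0 k.+1 _ n0) nk'.
have := inv_collatz_odd_run _ _ n0 nk; have := T_le _ _ n0 nk.
have : (2 / 3) ^+ k * n%:R^-1 <= (2 / 3) ^+ j * n%:R^-1 :> rat.
  by rewrite ler_wpM2r ?invr_ge0 ?ler0n // exp23_le.
lra.
Qed.

(** * Blocks of consecutive terms and their summation *)

Lemma inv_nat_le (a b n X : nat) : (0 < a)%N -> (0 < X)%N -> (a * X <= b * n)%N ->
  n%:R^-1 <= b%:R / a%:R * X%:R^-1 :> rat.
Proof.
move=> a0 X0 le; have n0 : (0 < n)%N.
  by case: n le => //; rewrite muln0 leqn0 muln_eq0; lia.
rewrite -[leLHS]mul1r ler_pdivrMr ?ltr0n // mulrAC ler_pdivlMr ?ltr0n // mul1r.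
by rewrite mulrAC ler_pdivlMr ?ltr0n // -!natrM ler_nat mulnC.
Qed.

(* Third case: k_i = 3 and k_(i+1) >= 5, where the two-term sum may exceed
   2 * 97/54. *)
Lemma T_blocks (X0 : nat) (n_ k_ : nat -> nat) (y := X0%:R^-1 : rat)
    (T_ := fun i => T (n_ i) (k_ i)) :
  (0 < X0)%N ->
  (forall i, (X0 < n_ i)%N) ->
  (forall i, odd_run (n_ i) (k_ i)) ->
  (forall i, ~~ odd (iter (k_ i).+1 collatz (n_ i)) -> (X0 < (n_ i)./2)%N) ->
  (forall i, odd (iter (k_ i).+1 collatz (n_ i)) ->
    n_ i.+1 = iter (k_ i).+1 collatz (n_ i)) ->
  forall i, [\/ T_ i <= 97 / 54 * y,
    T_ i + T_ i.+1 <= 97 / 27 * y |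
    T_ i + T_ i.+1 <= 35 / 9 * y /\
      T_ i + T_ i.+1 + T_ i.+2 <= 97 / 18 * y].
Proof.
move=> X_gt0 nX nk even_run odd_step i.
have y0 : 0 < y by rewrite invr_gt0 ltr0n.
have n0 j : (0 < n_ j)%N by have := nX j; lia.
have vy j : (n_ j)%:R^-1 <= y.
  have := @inv_nat_le 1 1 (n_ j) X0 isT X_gt0.
  by rewrite !mul1n divr1 mul1r; apply; exact: ltnW.
have v2y j : ~~ odd (iter (k_ j).+1 collatz (n_ j)) -> (n_ j)%:R^-1 <= 1 / 2 * y.
  by move=> /even_run h; apply: (@inv_nat_le 2 1); lia.
have T3 j := T_le3 _ _ (n0 j) (nk j).
have vi := vy i.
(* For k <= 2 the bound is 3(1 - 4/9) = 5/3 < 97/54. *)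
have [k2|k3] := leqP (k_ i) 2.
  by apply: Or31; have := T_le_small 2 _ _ (n0 i) (nk i) k2; rewrite -/(T_ i); lra.
have [oi|ei] := boolP (odd (iter (k_ i).+1 collatz (n_ i))); last first.
  by apply: Or31; have := T3 i; have := v2y i ei; rewrite -/(T_ i); lra.
have ni := odd_step i oi; have nki := nk i.+1; rewrite ni in nki.
(* The extremal case: k = 4 attains 65/27 + 32/27 = 97/27. *)
have [k4|] := ltnP 3 (k_ i).
  apply: Or32; have := T_pair_le 4 _ _ _ (n0 i) (nk i) nki k4.
  by rewrite -ni -/(T_ i) -/(T_ i.+1); lra.
rewrite leq_eqVlt ltnNge k3 orbF => /eqP ki.
have Ti : T_ i <= 19 / 9 * (n_ i)%:R^-1.
  by have := T_le _ _ (n0 i) (nk i); rewrite -/(T_ i) ki; lra.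
have vi1 := inv_collatz_odd_run _ _ (n0 i) (nk i).
rewrite -ni ki in vi1.
have [oi1|ei1] := boolP (odd (iter (k_ i.+1).+1 collatz (n_ i.+1))); last first.
  have h1 := even_run i.+1 ei1.
  (* A lower bound on n_(i+1) must be carried back to n_i, so exact values are used: n_i = 8q - 1
     and 2 n_(i+1) = 27q - 1 give 27 n_i = 16 n_(i+1) - 19 >= 32 X0. Then T_i <= (19/9)(27/32)/X0 =
     (57/32)/X0, and 57/32 < 97/54. *)
  have [q _ nq] := odd_runE _ _ (nk i); rewrite ki in nq.
  have q0 : (0 < q)%N by have := n0 i; lia.
  have e3 : iter 3 collatz (n_ i) = (3 ^ 3 * q).-1.
    by rewrite nq iter_collatz_pow2.
  have d1 : (n_ i.+1).*2 = (3 ^ 3 * q).-1.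
    by rewrite ni ki iterS collatz_even e3 // -e3 -ki; case: (nk i).
  have h : (32 * X0 <= 27 * n_ i)%N by lia.
  apply: Or31; have := @inv_nat_le 32 27 _ _ isT X_gt0 h.
  by rewrite -/y; lra.
have [k4|k5] := leqP (k_ i.+1) 4.
  apply: Or32; have := T_le_small 4 _ _ (n0 i.+1) (nk i.+1) k4.
  by rewrite -/(T_ i.+1); lra.
(* The two-term bound is 19/9 + 3 * 16/27 = 35/9. The long second run makes the third term small
   enough to restore the average. *)
apply: Or33; have := T3 i.+1; have := T3 i.+2.
have := inv_collatz_odd_run_ge 5 _ _ (n0 i.+1) (nk i.+1) k5.
by rewrite -(odd_step _ oi1) -/(T_ i.+1) -/(T_ i.+2); split; lra.
Qed.

(** Strong induction on m removes a leading block, hence the free starting index i. *)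
Lemma sum_T_lt (X0 : nat) (n_ k_ : nat -> nat) (y := X0%:R^-1 : rat)
    (T_ := fun i => T (n_ i) (k_ i)) :
  (0 < X0)%N ->
  (forall i, T_ i <= 3 * y) ->
  (forall i, [\/ T_ i <= 97 / 54 * y,
    T_ i + T_ i.+1 <= 97 / 27 * y |
    T_ i + T_ i.+1 <= 35 / 9 * y /\
      T_ i + T_ i.+1 + T_ i.+2 <= 97 / 18 * y]) ->
  forall m i, \sum_(0 <= j < m) T_ (j + i)%N < (97 * m + 73)%N%:R / 54 * y.
Proof.
move=> X_gt0 T3 step; have y0 : 0 < y by rewrite invr_gt0 ltr0n.
have S m i : \sum_(0 <= j < m.+1) T_ (j + i)%N
    = T_ i + \sum_(0 <= j < m) T_ (j + i.+1)%N.
  rewrite big_nat_recl //; congr (_ + _).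
  by apply: eq_bigr => j _; rewrite addSnnS.
have S0 i : \sum_(0 <= j < 0) T_ (j + i)%N = 0 by rewrite big_geq.
elim/ltn_ind => -[|m] IH i; first by rewrite S0; lra.
have Ti := T3 i; rewrite S.
have [h|h|[h1 h2]] := step i.
- by have := IH m (ltnSn m) i.+1; rewrite !natrD !natrM; lra.
- case: m IH => [|m] IH; first by rewrite S0; lra.
  by have := IH m (leqW (ltnSn m)) i.+2; rewrite S !natrD !natrM; lra.
(* If the sum stops inside a block, one term costs 3 = 162/54 <= 170/54, and two terms of a triple
   cost 35/9 = 210/54 <= 267/54. The crude bound 6 for two terms would be too large. *)
- case: m IH => [|[|m]] IH; first by rewrite S0; lra.
    by rewrite S S0; lra.
  by have := IH m (leqW (leqW (ltnSn m))) i.+3; rewrite !S !natrD !natrM; lra.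
Qed.

Local Close Scope ring_scope.

Theorem theorem14
  (X0 : nat)
  (hX0 : 765 < X0)
  (hreach : forall n : nat, 0 < n -> n <= X0 ->
     exists t : nat, iter t collatz n = 1)
  (m : nat) (c : seq nat)
  (hc : m_cycle m c)
  (n_ : nat -> nat)
  (hn : lists_local_minima m c n_)
  (k_ : nat -> nat)
  (hk : forall i : nat, odd_run (n_ i) (k_ i))
  (m1 : nat) :
  (\sum_(1 <= i < m1.+1) T (n_ i) (k_ i)
    < ((97 * m1 + 73)%N%:R / 54%:R) * (1 / X0%:R))%R.
Proof.
have X_gt0 : 0 < X0 by lia.
have cyc : nontrivial_cycle c by case: hc.
have mem i : local_min c (n_ i.+1) /\ n_ i.+1 \in c.
  by apply/andP; rewrite -mem_filter; exact: lists_local_minima_mem hc hn.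
have nX i : X0 < n_ i.+1.
  by apply: (@merge_cycle_gt X0 c _ 0) => //; case: (mem i).
rewrite big_add1 /= mul1r.
(* The minima are numbered from 1 and the block lemmas from 0, hence the shift by [S]; the [+ 0] is
   the starting index in [sum_T_lt]. *)
have -> : (\sum_(0 <= i < m1) T (n_ i.+1) (k_ i.+1)
    = \sum_(0 <= i < m1) T (n_ (i + 0).+1) (k_ (i + 0).+1))%R.
  by apply: eq_bigr => i _; rewrite addn0.
apply: (@sum_T_lt X0 (n_ \o S) (k_ \o S)) => // [i|] /=.
  apply: le_trans (T_le3 _ _ _ (hk i.+1)) _; first by have := nX i; lia.
  by rewrite ler_wpM2l // lef_pV2 ?posrE ?ltr0n ?ler_nat //; have := nX i; lia.
apply: (@T_blocks X0 (n_ \o S) (k_ \o S)) => //= i.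
(* Half of n_(i+1) need not lie on the cycle, but its trajectory enters it, which is enough to
   exceed X0. *)
- move=> /(odd_run_merge _ _ (hk i.+1)) E.
  apply: (@merge_cycle_gt X0 c _ (k_ i.+1).+1) => //.
  by rewrite E iter_collatz_cycle //; case: (mem i).
- move=> oi; rewrite (lists_local_minima_next m c) //.
  by have [? ?] := mem i; exact: next_local_min.
Qed.
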